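(* Let $K$ be a real closed field with a compatible, non-trivial non-archimedean absolute value and let $X$ be a variety over $K$. The canonical map $\psi:X_r^{\mathrm{an}}\to X_r^{\mathrm{arch}}$, $(p_x,|\cdot|_x,<_x)\mapsto(p_x,<_x)$, is a homeomorphism.
   Context: Absolute values take values in $\mathbb{R}_{\ge0}$; a non-archimedean absolute value on an ordered field is compatible with the order if $0\le a\le b$ implies $|a|\le|b|$. A variety over $K$ is a reduced, irreducible, separated scheme of finite type over $K$. For a scheme point $p\in X$, $K(p)$ is its residue field. Real analytification: $X_r^{\mathrm{an}}$ is the set of triples $x=(p_x,|\cdot|_x,<_x)$ where $p_x\in X$, $|\cdot|_x$ is a non-archimedean absolute value on $K(p_x)$ extending $|\cdot|_K$, and $<_x$ is an order on $K(p_x)$ compatible with $|\cdot|_x$. It carries the coarsest topology such that the support map $\operatorname{supp}:X_r^{\mathrm{an}}\to X$, $x\mapsto p_x$, is continuous and, for every open $U\subset X$ and every regular function $f$ on $U$, the map $\operatorname{supp}^{-1}(U)\to\mathbb{R}$, $x\mapsto\operatorname{sgn}_x(f)\cdot|f|_x$, is continuous. Real spectrum: $X_r$ is the set of pairs $(p,P)$ with $p\in X$ and $P$ an ordering of $K(p)$ (written as the set of nonnegative elements). For $X=\operatorname{Spec}(A)$ affine the topology is generated by the sets $\{f>_P0\}$, $f\in A$; in general it is obtained by glueing over open affines. $X_r^{\mathrm{arch}}\subset X_r$ (with subspace topology) consists of those $(p,P)$ such that $K(p)$ is relatively archimedean over $K$: for every $b\in K(p)$ there exists $a\in K$ with $a-b\in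 P$. *)

(* Defs.v *)
From HB Require Import structures.
From mathcomp Require Import all_boot all_order all_algebra.
From mathcomp Require Import generic_quotient ring_quotient.
From mathcomp Require Import all_classical all_reals topology.

Set Implicit Arguments.
Unset Strict Implicit.
Unset Printing Implicit Defensive.

Import Order.TTheory GRing.Theory Num.Theory.
Import numFieldTopology.Exports.

Local Open Scope classical_set_scope.
Local Open Scope ring_scope.
Local Open Scope quotient_scope.

Identity Coercion set_Funclass : set >-> Funclass.

Definition homeomorphism (S T : topologicalType) (f : S -> T) : Prop :=
  continuous f /\
  exists g : T -> S, [/\ cancel f g, cancel g f & continuous g].

Definition generated_open (T : choiceType) (S : set (set T)) (W : set T) : Prop :=
  forall x, W x -> exists B, [/\ finI_from S id B, B x & B `<=` W].

Lemma generated_openI (T : choiceType) (S : set (set T)) (V W : set T) :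
  generated_open S V -> generated_open S W -> generated_open S (V `&` W).
Proof.
move=> gV gW x [/gV[A [SA Ax AV]] /gW[B [SB Bx BW]]].
exists (A `&` B); split => //; last by move=> y [/AV ? /BW ?].
exact: finI_fromI.
Qed.

Definition is_unit (A : comPzRingType) (x : A) : Prop := exists y, x * y = 1.

(* Equivalent to the existence of a unique maximal ideal, which then consists of
   the nonunits. *)
Definition is_local_ring (A : comPzRingType) : Prop :=
  ~ is_unit (0 : A) /\
  forall x y : A, ~ is_unit x -> ~ is_unit y -> ~ is_unit (x + y).

(* [g] exhibits [B] as the localization [A_f]. *)
Definition is_localization (A B : comPzRingType) (f : A) (g : A -> B) : Prop :=
  [/\ is_unit (g f),
      forall b : B, exists a n, b * g f ^+ n = g a
    & forall a : A, g a = 0 -> exists n, f ^+ n * a = 0].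

Record primeIdeal (A : comPzRingType) := PrimeIdeal {
  pideal :> set A;
  pideal0 : pideal 0;
  pidealD : forall x y, pideal x -> pideal y -> pideal (x + y);
  pidealM : forall a x, pideal x -> pideal (a * x);
  pideal_proper : ~ pideal 1;
  pideal_prime : forall x y, pideal (x * y) -> pideal x \/ pideal y }.

HB.instance Definition _ A := gen_eqMixin (primeIdeal A).
HB.instance Definition _ A := gen_choiceMixin (primeIdeal A).

Definition basic_open (A : comPzRingType) (f : A) : set (primeIdeal A) :=
  [set p : primeIdeal A | ~ p f].

HB.instance Definition _ (A : comPzRingType) :=
  isSubBaseTopological.Build (primeIdeal A) (range (@basic_open A)) id.

Record opens (T : topologicalType) := Opens {
  opens_set :> set T;
  opens_open : open opens_set }.

Definition opensT (T : topologicalType) : opens T := Opens (@openT T).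

Definition opensI (T : topologicalType) (U V : opens T) : opens T :=
  Opens (openI (opens_open U) (opens_open V)).

(* The rings of sections must be allowed to be zero: the sections over the
   empty set form the zero ring. *)
Record ringedSpace := RingedSpace {
  rs_top :> topologicalType;
  sect : opens rs_top -> comPzRingType;
  res : forall U V : opens rs_top, V `<=` U -> {rmorphism sect U -> sect V};
  res_id : forall (U : opens rs_top) (h : U `<=` U) (s : sect U), res h s = s;
  res_comp : forall (U V W : opens rs_top) (h1 : V `<=` U) (h2 : W `<=` V)
    (h3 : W `<=` U) (s : sect U), res h2 (res h1 s) = res h3 s;
  sheaf_inj : forall (U : opens rs_top) (I : Type) (W : I -> opens rs_top)
    (h : forall i, W i `<=` U), U `<=` \bigcup_i W i ->
    forall s t : sect U, (forall i, res (h i) s = res (h i) t) -> s = t;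
  sheaf_glue : forall (U : opens rs_top) (I : Type) (W : I -> opens rs_top)
    (h : forall i, W i `<=` U), U `<=` \bigcup_i W i ->
    forall s : forall i, sect (W i),
    (forall i j (h1 : opensI (W i) (W j) `<=` W i)
                (h2 : opensI (W i) (W j) `<=` W j),
       res h1 (s i) = res h2 (s j)) ->
    exists t : sect U, forall i, res (h i) t = s i }.

Arguments sect : clear implicits.
Arguments res {r} U V.

Section Stalk.
Variables (X : ringedSpace) (p : X).

Record localSection := LocalSection {
  ls_dom : opens X;
  ls_in : ls_dom p;
  ls_val : sect X ls_dom }.

HB.instance Definition _ := gen_eqMixin localSection.
HB.instance Definition _ := gen_choiceMixin localSection.

Definition germ_eq (s t : localSection) : bool :=
  `[< exists (W : opens X) (h1 : W `<=` ls_dom s) (h2 : W `<=` ls_dom t),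
        W p /\ res _ _ h1 (ls_val s) = res _ _ h2 (ls_val t) >].

Lemma germ_eq_refl : reflexive germ_eq.
Proof.
by move=> s; apply/asboolP; exists (ls_dom s), (fun _ h => h), (fun _ h => h);
  split=> //; exact: ls_in.
Qed.

Lemma germ_eq_sym : symmetric germ_eq.
Proof.
by move=> s t; apply/asboolP/asboolP=> -[W [h1 [h2 [Wp E]]]]; exists W, h2, h1.
Qed.

Lemma germ_eq_trans : transitive germ_eq.
Proof.
move=> t s u /asboolP[V [h1 [h2 [Vp E]]]] /asboolP[W [h3 [h4 [Wp F]]]].
have hV : opensI V W `<=` V by move=> x [].
have hW : opensI V W `<=` W by move=> x [].
apply/asboolP; exists (opensI V W), (subset_trans hV h1), (subset_trans hW h4).
split; first by split.
rewrite -(res_comp h1 hV) E (res_comp h2 hV (subset_trans hV h2)).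
by rewrite -(res_comp h4 hW) -F (res_comp h3 hW (subset_trans hV h2)).
Qed.

Canonical germ_equiv := EquivRel germ_eq germ_eq_refl germ_eq_sym germ_eq_trans.

Definition stalk := {eq_quot germ_equiv}.
HB.instance Definition _ := Choice.on stalk.

Definition germ (U : opens X) (h : U p) (s : sect X U) : stalk :=
  \pi_stalk (LocalSection h s).

Lemma germ_eqP (U V : opens X) (hU : U p) (hV : V p) s t :
  germ hU s = germ hV t <->
  exists (W : opens X) (h1 : W `<=` U) (h2 : W `<=` V),
    W p /\ res _ _ h1 s = res _ _ h2 t.
Proof.
split; first by move/eqmodP => /asboolP.
by move=> H; apply/eqmodP/asboolP.
Qed.

Lemma germ_res (U V : opens X) (hU : U p) (hV : V p) (h : V `<=` U) s :
  germ hV (res _ _ h s) = germ hU s.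
Proof.
apply/germ_eqP; exists V, (fun _ k => k), h; split=> //.
by rewrite res_id.
Qed.

Lemma stalkP (x : stalk) : exists (U : opens X) (h : U p) s, x = germ h s.
Proof.
by elim/quotW: x => -[U h s]; exists U, h, s.
Qed.

Lemma stalk2P (x y : stalk) :
  exists (U : opens X) (h : U p) s t, x = germ h s /\ y = germ h t.
Proof.
have [U [hU [s ->]]] := stalkP x; have [V [hV [t ->]]] := stalkP y.
have h1 : opensI U V `<=` U by move=> ? [].
have h2 : opensI U V `<=` V by move=> ? [].
have h : opensI U V p by split.
exists (opensI U V), h, (res _ _ h1 s), (res _ _ h2 t).
by rewrite !(germ_res _ h).
Qed.

Lemma stalk3P (x y z : stalk) : exists (U : opens X) (h : U p) s t u,
  [/\ x = germ h s, y = germ h t & z = germ h u].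
Proof.
have [U [hU [s [t [-> ->]]]]] := stalk2P x y.
have [V [hV [u ->]]] := stalkP z.
have h1 : opensI U V `<=` U by move=> ? [].
have h2 : opensI U V `<=` V by move=> ? [].
have h : opensI U V p by split.
exists (opensI U V), h, (res _ _ h1 s), (res _ _ h1 t), (res _ _ h2 u).
by rewrite !(germ_res _ h).
Qed.

Definition stalk_op2 (op : forall A : comPzRingType, A -> A -> A)
    (x y : stalk) : stalk :=
  let s := repr x in let t := repr y in
  let W := opensI (ls_dom s) (ls_dom t) in
  germ (conj (ls_in s) (ls_in t) : W p)
    (op _ (res (ls_dom s) W (@subIsetl _ _ _) (ls_val s))
          (res (ls_dom t) W (@subIsetr _ _ _) (ls_val t))).

Definition stalk0 : stalk := germ (I : opensT X p) 0.
Definition stalk1 : stalk := germ (I : opensT X p) 1.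
Definition stalk_opp (x : stalk) : stalk := germ (ls_in (repr x)) (- ls_val (repr x)).
Definition stalk_add := stalk_op2 (fun A => @GRing.add A).
Definition stalk_mul := stalk_op2 (fun A => @GRing.mul A).

Lemma stalk_op2E (op : forall A : comPzRingType, A -> A -> A) :
  (forall (A B : comPzRingType) (f : {rmorphism A -> B}) x y,
     f (op A x y) = op B (f x) (f y)) ->
  forall (U : opens X) (h : U p) s t,
    stalk_op2 op (germ h s) (germ h t) = germ h (op _ s t).
Proof.
move=> opM U h s t; rewrite /stalk_op2.
have : germ (ls_in (repr (germ h s))) (ls_val (repr (germ h s))) = germ h s.
  by rewrite -[RHS]reprK /germ; case: (repr _).
have : germ (ls_in (repr (germ h t))) (ls_val (repr (germ h t))) = germ h t.
  by rewrite -[RHS]reprK /germ; case: (repr _).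
case: (repr (germ h s)) => /= V hV s'; case: (repr (germ h t)) => /= V' hV' t'.
move=> /germ_eqP[W' [k1 [k2 [W'p E']]]] /germ_eqP[W [j1 [j2 [Wp E]]]].
have i1 : opensI W W' `<=` W by move=> ? [].
have i2 : opensI W W' `<=` W' by move=> ? [].
have q : opensI W W' `<=` opensI V V' by move=> x [/j1 ? /k1 ?].
apply/germ_eqP; exists (opensI W W'), q, (subset_trans i1 j2); split=> //.
rewrite !opM (res_comp _ q (subset_trans i1 j1)).
rewrite (res_comp _ q (subset_trans i2 k1)).
rewrite -(res_comp j1 i1) E (res_comp j2 i1 (subset_trans i1 j2)).
by rewrite -(res_comp k1 i2) E' (res_comp k2 i2 (subset_trans i1 j2)).
Qed.

Lemma germD (U : opens X) (h : U p) s t :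
  stalk_add (germ h s) (germ h t) = germ h (s + t).
Proof. by apply: stalk_op2E => A B f x y; rewrite rmorphD. Qed.

Lemma germM (U : opens X) (h : U p) s t :
  stalk_mul (germ h s) (germ h t) = germ h (s * t).
Proof. by apply: stalk_op2E => A B f x y; rewrite rmorphM. Qed.

Lemma germN (U : opens X) (h : U p) s : stalk_opp (germ h s) = germ h (- s).
Proof.
have : germ (ls_in (repr (germ h s))) (ls_val (repr (germ h s))) = germ h s.
  by rewrite -[RHS]reprK /germ; case: (repr _).
rewrite /stalk_opp; case: (repr (germ h s)) => /= V hV s'.
move=> /germ_eqP[W [j1 [j2 [Wp E]]]]; apply/germ_eqP; exists W, j1, j2.
by rewrite !rmorphN E.
Qed.

Lemma germ0 (U : opens X) (h : U p) : germ h 0 = stalk0.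
Proof. by rewrite /stalk0 -(@germ_res (opensT X) U I h (@subsetT _ U)) rmorph0. Qed.

Lemma germ1 (U : opens X) (h : U p) : germ h 1 = stalk1.
Proof. by rewrite /stalk1 -(@germ_res (opensT X) U I h (@subsetT _ U)) rmorph1. Qed.

Fact stalk_addA : associative stalk_add.
Proof.
by move=> x y z; have [U [h [s [t [u [-> -> ->]]]]]] := stalk3P x y z;
  rewrite !germD addrA.
Qed.

Fact stalk_addC : commutative stalk_add.
Proof.
by move=> x y; have [U [h [s [t [-> ->]]]]] := stalk2P x y;
  rewrite !germD addrC.
Qed.

Fact stalk_add0 : left_id stalk0 stalk_add.
Proof.
by move=> x; have [U [h [s ->]]] := stalkP x; rewrite -(germ0 h) germD add0r.
Qed.

Fact stalk_addN : left_inverse stalk0 stalk_opp stalk_add.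
Proof.
by move=> x; have [U [h [s ->]]] := stalkP x; rewrite germN germD addNr germ0.
Qed.

Fact stalk_mulA : associative stalk_mul.
Proof.
by move=> x y z; have [U [h [s [t [u [-> -> ->]]]]]] := stalk3P x y z;
  rewrite !germM mulrA.
Qed.

Fact stalk_mulC : commutative stalk_mul.
Proof.
by move=> x y; have [U [h [s [t [-> ->]]]]] := stalk2P x y;
  rewrite !germM mulrC.
Qed.

Fact stalk_mul1 : left_id stalk1 stalk_mul.
Proof.
by move=> x; have [U [h [s ->]]] := stalkP x; rewrite -(germ1 h) germM mul1r.
Qed.

Fact stalk_mulDl : left_distributive stalk_mul stalk_add.
Proof.
by move=> x y z; have [U [h [s [t [u [-> -> ->]]]]]] := stalk3P x y z;
  rewrite !(germM, germD) mulrDl.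
Qed.

HB.instance Definition _ := GRing.isZmodule.Build stalk
  stalk_addA stalk_addC stalk_add0 stalk_addN.
HB.instance Definition _ := GRing.Zmodule_isComPzRing.Build stalk
  stalk_mulA stalk_mulC stalk_mul1 stalk_mulDl.

Fact germ_is_zmod_morphism (U : opens X) (h : U p) : zmod_morphism (@germ U h).
Proof. by move=> s t; rewrite -germD -germN. Qed.

Fact germ_is_monoid_morphism (U : opens X) (h : U p) :
  monoid_morphism (@germ U h).
Proof. by split=> [|s t]; [exact: germ1 | rewrite -germM]. Qed.

HB.instance Definition _ (U : opens X) (h : U p) :=
  GRing.isZmodMorphism.Build (sect X U) stalk (germ h)
    (germ_is_zmod_morphism h).
HB.instance Definition _ (U : opens X) (h : U p) :=
  GRing.isMonoidMorphism.Build (sect X U) stalk (germ h)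
    (germ_is_monoid_morphism h).

End Stalk.

Record lrSpace := LRSpace {
  lr_rs :> ringedSpace;
  lr_local : forall p : lr_rs, is_local_ring (stalk p) }.

Section Residue.
Variables (X : lrSpace) (p : X).
Local Notation A := (@stalk (lr_rs X) p).

Fact stalk_nontrivial : (1 : A) != 0.
Proof.
apply/eqP => E; case: (lr_local p) => + _; apply.
by exists 1; rewrite mulr1 E.
Qed.

HB.instance Definition _ :=
  GRing.PzSemiRing_isNonZero.Build A stalk_nontrivial.

Definition max_ideal : pred A := fun x => `[< ~ is_unit x >].

Fact max_ideal_closed : idealr_closed max_ideal.
Proof.
have [nu0 nuD] := lr_local p; split.
- by apply/asboolP.
- by apply/asboolP; apply; exists 1; rewrite mulr1.
- move=> a u v /asboolP nu /asboolP nv; apply/asboolP/nuD => // -[y E].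
  by apply: nu; exists (a * y); rewrite mulrCA mulrA.
Qed.

HB.instance Definition _ := isIdealr.Build A max_ideal max_ideal_closed.

Definition residue := @Quotient.quot A [the idealr A of max_ideal].
HB.instance Definition _ := GRing.ComNzRing.on residue.

Definition stalk_eval (x : A) : residue := \pi_residue x.

Fact stalk_eval_is_zmod_morphism : zmod_morphism stalk_eval.
Proof. by move=> x y; rewrite /stalk_eval; exact: raddfB. Qed.

Fact stalk_eval_is_monoid_morphism : monoid_morphism stalk_eval.
Proof. by rewrite /stalk_eval; split=> [|x y]; [exact: rmorph1 | exact: rmorphM]. Qed.

HB.instance Definition _ := GRing.isZmodMorphism.Build A residue stalk_eval
  stalk_eval_is_zmod_morphism.
HB.instance Definition _ := GRing.isMonoidMorphism.Build A residue stalk_eval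
  stalk_eval_is_monoid_morphism.

Lemma stalk_eval_eq0 x : stalk_eval x = 0 <-> ~ is_unit x.
Proof.
have idealE : stalk_eval x = stalk_eval 0 <-> Quotient.equiv [the idealr A of max_ideal] x 0.
  by split=> [/eqP|?]; [|apply/eqP]; rewrite eqmodE.
rewrite -[RHS](rmorph0 stalk_eval).
split=> [/idealE|nx]; first by rewrite Quotient.equivE subr0 => /asboolP.
by apply/idealE; rewrite Quotient.equivE subr0; apply/asboolP.
Qed.

Fact residue_inv_ex (x : residue) : x != 0 -> exists y, y * x = 1.
Proof.
elim/quotW: x => x; rewrite -/(stalk_eval x) => /eqP nx.
have [y E] : is_unit x.
  by apply: contrapT => n; apply: nx; apply/stalk_eval_eq0.
by exists (stalk_eval y); rewrite -rmorphM mulrC E rmorph1.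
Qed.

Definition residue_inv (x : residue) : residue :=
  if pselect (exists y, y * x = 1) is left h then projT1 (cid h) else 0.

Fact residue_mulVf (x : residue) : x != 0 -> residue_inv x * x = 1.
Proof.
move=> /residue_inv_ex nx; rewrite /residue_inv.
by case: pselect => // h; case: cid.
Qed.

Fact residue_inv0 : residue_inv 0 = 0.
Proof.
rewrite /residue_inv; case: pselect => // h; exfalso.
by case: h => y /esym/eqP; rewrite mulr0 oner_eq0.
Qed.

HB.instance Definition _ :=
  GRing.ComNzRing_isField.Build residue residue_mulVf residue_inv0.

Definition value (U : opens X) (h : U p) (f : sect X U) : residue :=
  stalk_eval (germ h f).

End Residue.

(* The ringed space [(V, O_V)] is isomorphic to [Spec A]: the structure sheaf
   of [Spec A] is determined by [D(f) |-> A_f] on the basic open sets. *)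
Definition is_affine (X : ringedSpace) (V : opens X) : Prop :=
  exists (A : comPzRingType) (rho : {rmorphism A -> sect X V})
         (phi : set_type V -> primeIdeal A),
    homeomorphism phi /\
    forall (f : A) (U : opens X) (h : U `<=` V),
      opens_set U = set_val @` (phi @^-1` basic_open f) ->
      is_localization f (res V U h \o rho).

Record scheme := Scheme {
  sch_lr :> lrSpace;
  sch_affine : forall p : sch_lr, exists V : opens sch_lr, V p /\ is_affine V }.

(* A morphism to [Spec K], [K] a field, amounts to a ring morphism from [K]
   to the global sections. *)
Record kscheme (K : fieldType) := KScheme {
  ks_scheme :> scheme;
  ks_str : {rmorphism K -> sect ks_scheme (opensT ks_scheme)} }.

Section Morphisms.
Variable K : fieldType.

(* [km_local] says that the induced morphisms on stalks are local. *)
Record kmorphism (X Y : kscheme K) := KMorphism {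
  km_fun :> X -> Y;
  km_cts : forall V : opens Y, open (km_fun @^-1` V);
  km_sect : forall V : opens Y,
    {rmorphism sect Y V -> sect X (Opens (km_cts V))};
  km_res : forall (U V : opens Y) (h : V `<=` U)
    (h' : km_fun @^-1` V `<=` km_fun @^-1` U) (s : sect Y U),
    km_sect V (res U V h s)
    = res (Opens (km_cts U)) (Opens (km_cts V)) h' (km_sect U s);
  km_local : forall (x : X) (V : opens Y) (h : V (km_fun x)) (s : sect Y V),
    is_unit (@germ X x (Opens (km_cts V)) h (km_sect V s)) ->
    is_unit (germ h s);
  km_str : forall (a : K) (h : Opens (km_cts (opensT Y)) `<=` opensT X),
    km_sect (opensT Y) (ks_str Y a) = res _ _ h (ks_str X a) }.

Section Identity.
Variable X : kscheme K.

Definition kid_cts (V : opens X) : open (@id X @^-1` V) := opens_open V.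

Definition kid_sect (V : opens X) :
  {rmorphism sect X V -> sect X (Opens (kid_cts V))} :=
  res V (Opens (kid_cts V)) (fun _ h => h).

Fact kid_res (U V : opens X) (h : V `<=` U) (h' : id @^-1` V `<=` id @^-1` U) s :
  kid_sect V (res U V h s)
  = res (Opens (kid_cts U)) (Opens (kid_cts V)) h' (kid_sect U s).
Proof.
have k : Opens (kid_cts V) `<=` U by exact: h.
by rewrite /kid_sect (res_comp h _ k) 
  (@res_comp X U (Opens (kid_cts U)) (Opens (kid_cts V)) _ h' k).
Qed.

Fact kid_local (x : X) (V : opens X) (h : V x) s :
  is_unit (@germ X x (Opens (kid_cts V)) h (kid_sect V s)) -> is_unit (germ h s).
Proof. by rewrite /kid_sect (germ_res h). Qed.

Fact kid_str (a : K) (h : Opens (kid_cts (opensT X)) `<=` opensT X) :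
  kid_sect (opensT X) (ks_str X a) = res _ _ h (ks_str X a).
Proof. by rewrite /kid_sect; congr (res _ _ _ _); exact: Prop_irrelevance. Qed.

Definition kid : kmorphism X X := KMorphism kid_res kid_local kid_str.
End Identity.

Section Composition.
Variables (X Y Z : kscheme K) (g : kmorphism Y Z) (f : kmorphism X Y).

Definition kcomp_cts (V : opens Z) : open ((g \o f) @^-1` V) :=
  km_cts f (Opens (km_cts g V)).

Definition kcomp_sect (V : opens Z) :
    {rmorphism sect Z V -> sect X (Opens (kcomp_cts V))} :=
  km_sect f (Opens (km_cts g V)) \o km_sect g V.

Fact kcomp_res (U V : opens Z) (h : V `<=` U)
    (h' : (g \o f) @^-1` V `<=` (g \o f) @^-1` U) s :
  kcomp_sect V (res U V h s)
  = res (Opens (kcomp_cts U)) (Opens (kcomp_cts V)) h' (kcomp_sect U s).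
Proof.
have k : g @^-1` V `<=` g @^-1` U by move=> y /h.
rewrite /= (km_res h k).
exact: (@km_res _ _ f (Opens (km_cts g U)) (Opens (km_cts g V)) k h').
Qed.

Fact kcomp_local (x : X) (V : opens Z) (h : V ((g \o f) x)) s :
  is_unit (@germ X x (Opens (kcomp_cts V)) h (kcomp_sect V s)) ->
  is_unit (germ h s).
Proof.
by move=> u; apply: (@km_local _ _ g (f x) V h s);
  exact: (@km_local _ _ f x (Opens (km_cts g V)) h).
Qed.

Fact kcomp_str (a : K) (h : Opens (kcomp_cts (opensT Z)) `<=` opensT X) :
  kcomp_sect (opensT Z) (ks_str Z a) = res _ _ h (ks_str X a).
Proof.
have k : Opens (km_cts g (opensT Z)) `<=` opensT Y by [].
have l : Opens (km_cts f (opensT Y)) `<=` opensT X by [].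
have m : f @^-1` Opens (km_cts g (opensT Z)) `<=` f @^-1` opensT Y by [].
rewrite /= (km_str a k).
rewrite (@km_res _ _ f (opensT Y) (Opens (km_cts g (opensT Z))) k m).
by rewrite (km_str a l) (@res_comp X (opensT X) (Opens (km_cts f (opensT Y))) (Opens (kcomp_cts (opensT Z))) l m h).
Qed.

Definition kcomp : kmorphism X Z := KMorphism kcomp_res kcomp_local kcomp_str.
End Composition.

(* The fibre product over [Spec K] is the product among [K]-schemes. *)
Definition is_self_product (X P : kscheme K) (p1 p2 : kmorphism P X) : Prop :=
  forall (T : kscheme K) (a b : kmorphism T X),
    exists! h : kmorphism T P, kcomp p1 h = a /\ kcomp p2 h = b.

Definition closed_immersion (X Y : kscheme K) (f : kmorphism X Y) : Prop :=
  [/\ closed (range f),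
      exists g : X -> set_type (range f),
        homeomorphism g /\ forall x, set_val (g x) = f x
    & forall (V : opens Y) (y : Y) (s : sect X (Opens (km_cts f V))), V y ->
      exists (W : opens Y) (h : f @^-1` W `<=` f @^-1` V) (t : sect Y W),
        [/\ W `<=` V, W y
          & km_sect f W t
            = res (Opens (km_cts f V)) (Opens (km_cts f W)) h s]].

Definition separated (X : kscheme K) : Prop :=
  exists (P : kscheme K) (p1 p2 : kmorphism P X) (D : kmorphism X P),
    [/\ is_self_product p1 p2, kcomp p1 D = kid X, kcomp p2 D = kid X
      & closed_immersion D].

Definition ksect (X : kscheme K) (V : opens X) (a : K) : sect X V :=
  res (opensT X) V (@subsetT _ _) (ks_str X a).

(* [sect X V] is a finitely generated [K]-algebra. *)
Definition sect_fg (X : kscheme K) (V : opens X) : Prop :=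
  exists g : seq (sect X V), forall S : set (sect X V),
    (forall a, S (ksect V a)) ->
    (forall x, x \in g -> S x) ->
    (forall x y, S x -> S y -> S (x + y)) ->
    (forall x y, S x -> S y -> S (x * y)) ->
    forall x, S x.

Definition finite_type (X : kscheme K) : Prop :=
  exists (n : nat) (V : 'I_n -> opens X),
    (forall x : X, exists i, V i x) /\
    (forall i, is_affine (V i) /\ sect_fg (V i)).

End Morphisms.

Definition reduced (X : ringedSpace) : Prop :=
  forall (U : opens X) (s : sect X U) (n : nat), s ^+ n = 0 -> s = 0.

Definition irreducible (T : topologicalType) : Prop :=
  [set: T] !=set0 /\
  forall A B : set T, closed A -> closed B -> A `|` B = setT ->
    A = setT \/ B = setT.

Definition is_variety (K : fieldType) (X : kscheme K) : Prop :=
  [/\ reduced X, irreducible X, separated X & finite_type X].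

Record ordering (F : fieldType) := Ordering {
  nonneg :> set F;
  nonnegD : forall x y, nonneg x -> nonneg y -> nonneg (x + y);
  nonnegM : forall x y, nonneg x -> nonneg y -> nonneg (x * y);
  nonneg_total : forall x, nonneg x \/ nonneg (- x);
  nonneg_anti : forall x, nonneg x -> nonneg (- x) -> x = 0 }.

Definition pos_for (F : fieldType) (P : ordering F) (x : F) : Prop :=
  P x /\ x <> 0.

Definition sgn_for (R : realType) (F : fieldType) (P : ordering F) (x : F) : R :=
  if x == 0 then 0 else if `[< P x >] then 1 else -1.

Record nonarch_abs (F : fieldType) (R : realType) := NonarchAbs {
  abs :> F -> R;
  abs_ge0 : forall x, 0 <= abs x;
  abs_eq0 : forall x, abs x = 0 <-> x = 0;
  absM : forall x y, abs (x * y) = abs x * abs y;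
  absD : forall x y, abs (x + y) <= Num.max (abs x) (abs y) }.

Definition compatible (F : fieldType) (R : realType) (v : nonarch_abs F R)
    (P : ordering F) : Prop :=
  forall a b : F, P a -> P (b - a) -> v a <= v b.

Definition kvalue (K : fieldType) (X : kscheme K) (p : X) (a : K) : residue p :=
  @value X p (opensT X) I (ks_str X a).

Section Analytification.
Variables (K : fieldType) (R : realType) (v : nonarch_abs K R) (X : kscheme K).

(* [an_ord] need not be required to extend the order of a real closed [K]:
   nonnegative elements of [K] are squares. *)
Record an_space := AnPoint {
  an_supp : X;
  an_abs : nonarch_abs (residue an_supp) R;
  an_ord : ordering (residue an_supp);
  an_ext : forall a : K, an_abs (kvalue an_supp a) = v a;
  an_compat : compatible an_abs an_ord }.

HB.instance Definition _ := gen_eqMixin an_space.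
HB.instance Definition _ := gen_choiceMixin an_space.

Definition an_eval (U : opens X) (f : sect X U) (x : an_space)
    (h : U (an_supp x)) : R :=
  sgn_for R (an_ord x) (value h f) * an_abs x (value h f).

(* The coarsest topology for which the [supp^-1(U)] are open and the
   [an_eval f : supp^-1(U) -> R] are continuous. *)
Definition an_subbase : set (set an_space) :=
  [set an_supp @^-1` U | U in [set U : set X | open U]] `|`
  [set W | exists (U : opens X) (f : sect X U) (V : set R), open V /\
     W = [set x | exists h : U (an_supp x), V (an_eval f h)]].

HB.instance Definition _ := isSubBaseTopological.Build an_space an_subbase id.

End Analytification.

Section RealSpectrum.
Variables (K : fieldType) (X : kscheme K).

Record real_space := RealPoint {
  real_supp : X;
  real_ord : ordering (residue real_supp) }.

HB.instance Definition _ := gen_eqMixin real_space.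
HB.instance Definition _ := gen_choiceMixin real_space.

Definition pos_locus (V : opens X) (f : sect X V) : set real_space :=
  [set x | exists h : V (real_supp x), pos_for (real_ord x) (value h f)].

(* Gluing the real spectra of the affine open subsets [V]; the real spectrum of
   [V] is [real_supp @^-1` V], which is also [pos_locus 1]. *)
Definition real_open (W : set real_space) : Prop :=
  forall V : opens X, is_affine V ->
    generated_open (range (@pos_locus V)) (W `&` real_supp @^-1` V).

Lemma pos_locus1 (V : opens X) : @pos_locus V 1 = real_supp @^-1` V.
Proof.
apply/seteqP; split=> [x [] //|x h]; exists h.
rewrite /value !rmorph1; split; last exact/eqP/oner_neq0.
case: (nonneg_total (real_ord x) 1) => // h1.
by rewrite -[1]mulr1 -mulrNN; exact: nonnegM.
Qed.

Fact real_openT : real_open setT.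
Proof.
move=> V _; rewrite setTI => x h; exists (real_supp @^-1` V); split=> //.
by apply: finI_from1 => //; exists 1 => //; rewrite pos_locus1.
Qed.

Fact real_openI : setI_closed real_open.
Proof.
by move=> A B oA oB V aV; rewrite setIIl; apply: generated_openI; [exact: oA|exact: oB].
Qed.

Fact real_open_bigU (I : Type) (f : I -> set real_space) :
  (forall i, real_open (f i)) -> real_open (\bigcup_i f i).
Proof.
move=> of_ V aV x [[i _ fix_] Vx].
have [B [SB Bx sB]] := of_ i V aV x (conj fix_ Vx).
by exists B; split=> // y /sB[? ?]; split=> //; exists i.
Qed.

HB.instance Definition _ :=
  isOpenTopological.Build real_space real_openT real_openI real_open_bigU.

Definition arch_locus : set real_space :=
  [set x | forall b : residue (real_supp x),
     exists a : K, real_ord x (kvalue (real_supp x) a - b)].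

End RealSpectrum.

Arguments arch_locus {K} X _.

Definition forget_abs (K : fieldType) (R : realType) (v : nonarch_abs K R)
    (X : kscheme K) (x : an_space v X) : real_space X :=
  RealPoint (an_ord x).

(* Main.v *)
(* Square roots make the value group of a nontrivially valued real closed field
   [K] dense in the positive reals. Hence an order-compatible absolute value
   extending that of [K] to an ordered field [L] makes [L] archimedean over [K],
   and is determined by the order: [|b|] is the infimum of the [v a] for [a] in
   [K] bounding [|b|] in the order. Conversely, this infimum defines a compatible
   absolute value when [L] is archimedean over [K], the density of the value
   group giving [|1/b| <= 1/|b|]. This is the bijection.

   The map is continuous because [f > 0] iff the signed absolute value of [f] is
   positive. For the inverse, the signed absolute value of [f] at a point lies in
   an open interval iff [a < f < b] there for some [a], [b] in [K] whose signed
   absolute values lie in the interval, and [f - a > 0] is an open condition on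
   the real spectrum. As [f] is only a section over an arbitrary open set, the
   latter needs that on a basic open set [D(h)] of an affine open set, [f] is
   [a / h^n], of the same sign as the global section [a h^(n+2)]. *)

Require Import Defs.
From HB Require Import structures.
From mathcomp Require Import all_boot all_order all_algebra.
From mathcomp Require Import all_classical all_reals topology.

Import Order.TTheory GRing.Theory Num.Theory.
Import numFieldTopology.Exports.
Local Open Scope classical_set_scope.
Local Open Scope ring_scope.

(** * Elementary rules for non-archimedean absolute values *)

Section AbsoluteValue.
Context {F : fieldType} {R : realType} (w : nonarch_abs F R).

Lemma abs_gt0 (x : F) : x != 0 -> 0 < w x.
Proof.
move=> x0; rewrite lt0r abs_ge0 andbT.
by apply: contra_neq x0 => /abs_eq0.
Qed.

Lemma abs1 : w 1 = 1.
Proof.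
have w1 : w 1 != 0 by rewrite gt_eqF// abs_gt0// oner_eq0.
by apply: (mulfI w1); rewrite -absM !mulr1.
Qed.

Lemma absN (x : F) : w (- x) = w x.
Proof.
suff wN1 : w (-1) = 1 by rewrite -mulN1r absM wN1 mul1r.
have /eqP : w (-1) ^+ 2 = 1 by rewrite expr2 -absM mulrNN mulr1 abs1.
by rewrite sqrp_eq1 ?abs_ge0// => /eqP.
Qed.

Lemma absX (x : F) n : w (x ^+ n) = w x ^+ n.
Proof. by elim: n => [|n IH]; rewrite ?abs1// !exprS absM IH. Qed.

Lemma absV (x : F) : w x^-1 = (w x)^-1.
Proof.
have [->|x0] := eqVneq x 0; first by rewrite invr0 (abs_eq0 w 0).2// invr0.
have wx0 : w x != 0 by rewrite gt_eqF// abs_gt0.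
by apply: (mulfI wx0); rewrite -absM !divff// abs1.
Qed.

End AbsoluteValue.

(** * Density of the value group of a real closed field *)

Section ValueGroup.
Context {R : realType} {K : rcfType} (v : nonarch_abs K R).
Hypothesis v_nontrivial : exists a : K, a <> 0 /\ v a <> 1.

Lemma exists_abs_gt1 : exists2 c : K, 0 < c & 1 < v c.
Proof.
have [a [/eqP a0 /eqP va1]] := v_nontrivial.
have vn : v `|a| = v a by case: (ger0P a) => _ //; rewrite absN.
have [va|va] := ltP 1 (v a); first by exists `|a|; rewrite ?normr_gt0// vn.
exists `|a|^-1; first by rewrite invr_gt0 normr_gt0.
by rewrite absV vn invf_gt1 ?abs_gt0// lt_neqAle va1.
Qed.

Lemma exists_root2n (c : K) n : 0 < c -> exists2 d : K, 0 < d & d ^+ (2 ^ n) = c.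
Proof.
elim: n c => [|n IH] c c0; first by exists c.
have [d d0 dE] := IH (Num.sqrt c) ltac:(by rewrite sqrtr_gt0).
by exists d => //; rewrite expnSr exprM dE sqr_sqrtr// ltW.
Qed.


(** Bernoulli's inequality [1 + n (r - 1) <= r ^ n], combined with the archimedean property of the
    reals. *)
Lemma expr_unbounded (r M : R) : 1 < r -> exists n, M < r ^+ n.
Proof.
move=> r1; have x0 : 0 < r - 1 by rewrite subr_gt0.
have bern n : 1 + (r - 1) *+ n <= r ^+ n.
  elim: n => [|n IH]; first by rewrite addr0.
  rewrite exprS mulrSr addrA; apply: (@le_trans _ _ (r ^+ n + (r - 1))).
    by rewrite lerD2r.
  rewrite -{3}[r](subrK 1) mulrDl mul1r [leRHS]addrC lerD2l ler_peMr ?(ltW x0)//.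
  by rewrite exprn_ege1// ltW.
pose n := Num.bound (M / (r - 1)); exists n.
apply: lt_le_trans (bern n).
have [M0|M0] := ltP M 0; first by rewrite (lt_trans M0)// ltr_wpDr// mulrn_wge0// ltW.
have : M / (r - 1) < n%:R by apply: archi_boundP; rewrite divr_ge0// ltW.
by rewrite ltr_pdivrMr// mulr_natl => /lt_trans; apply; rewrite ltrDr ltr01.
Qed.

(* Roots of an element of absolute value > 1 have absolute values decreasing
   to 1, and the powers of such a root are finely spaced. *)
Lemma abs_dense_pos (s t : R) : 0 <= s -> s < t ->
  exists2 a : K, 0 < a & s < v a < t.
Proof.
(* For [s = 0] the interval from [t / 2] to [t] is used instead, which allows division by [s]
   below. *)
wlog s0 : s / 0 < s.
  move=> wl; rewrite le_eqVlt => /predU1P[<- t0|s0 st]; last exact: wl s0 (ltW s0) st.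
  have t2 : 0 < t / 2 by rewrite divr_gt0.
  have [a a0 /andP[sa at_]] := wl _ t2 (ltW t2) ltac:(by rewrite ltr_pdivrMr// ltr_pMr// ltr1n).
  by exists a => //; rewrite at_ (lt_trans t2).
move=> _ st; have r1 : 1 < t / s by rewrite ltr_pdivlMr// mul1r.
have [c c0 vc] := exists_abs_gt1.
(* Since [v c < (t / s) ^ n <= (t / s) ^ (2 ^ n)], a [2 ^ n]-th root of [c] has absolute value below
   [t / s]. *)
have [n cn] := expr_unbounded _ (v c) r1.
have [d d0 dE] := exists_root2n _ n c0.
have vd1 : 1 < v d.
  by rewrite -(@expr_gt1 _ (2 ^ n)) ?expn_gt0// ?abs_ge0// -absX dE.
have vdr : v d < t / s.
  rewrite -(@ltr_pXn2r _ (2 ^ n)) ?expn_gt0// ?nnegrE ?abs_ge0//; last first.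
    by rewrite ltW// (lt_trans ltr01).
  rewrite -absX dE (lt_le_trans cn)// ler_eXn2l//.
  by rewrite ltnW// ltn_expl.
have vd0 : 0 < v d by rewrite (lt_trans ltr01).
(* As [s * v d ^ N] exceeds 1, the least exponent whose power of [v d] exceeds it is some [k + 1].
   The power for [k] does not exceed it, and the factor [v d < t / s] keeps the next one below
   [t * v d ^ N]. *)
have [N Ns] := expr_unbounded _ s^-1 vd1.
have [k0 hk0] := expr_unbounded _ (s * v d ^+ N) vd1.
have ex : exists k, s * v d ^+ N < v d ^+ k by exists k0.
case: (ex_minnP ex) => -[|k] hk kmin.
  by move: hk; rewrite expr0 mulrC -ltr_pdivlMr// div1r ltNge ltW.
exists (d ^+ k.+1 / d ^+ N); first by rewrite divr_gt0// exprn_gt0.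
rewrite absM absV !absX ltr_pdivlMr ?exprn_gt0// hk/=.
rewrite ltr_pdivrMr ?exprn_gt0//.
have : v d ^+ k <= s * v d ^+ N.
  by rewrite leNgt; apply/negP => /kmin; rewrite ltnn.
move=> /(ler_wpM2l (abs_ge0 v d)); rewrite -exprS => /le_lt_trans; apply.
by rewrite mulrA ltr_pM2r ?exprn_gt0// -ltr_pdivlMr.
Qed.

End ValueGroup.

(** * The signed absolute value on an ordered field *)

Definition signed_abs {F : realDomainType} {R : realType} (w : F -> R) (x : F) : R :=
  if 0 <= x then w x else - w x.

Section SignedAbs.
Context {F : realFieldType} {R : realType} (w : nonarch_abs F R).
Hypothesis w_compatible : forall a b : F, 0 <= a -> a <= b -> w a <= w b.

Lemma signed_absN (x : F) : signed_abs w (- x) = - signed_abs w x.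
Proof.
rewrite /signed_abs oppr_ge0 absN; case: ltgtP => [| |->]; rewrite ?opprK//.
by rewrite (abs_eq0 w 0).2// oppr0.
Qed.

Lemma signed_abs_le (x y : F) : x <= y -> signed_abs w x <= signed_abs w y.
Proof.
move=> xy; rewrite /signed_abs.
have [y0|y0] := leP 0 y; have [x0|x0] := leP 0 x.
- exact: w_compatible.
- by rewrite (@le_trans _ _ 0)// ?oppr_le0 abs_ge0.
- by move: (lt_le_trans y0 x0); rewrite ltNge xy.
- by rewrite lerN2 -absN -(absN w x) w_compatible ?lerN2// oppr_ge0 ltW.
Qed.

(** Contrapositive of monotonicity: strict inequalities are reflected, whereas only weak ones are
    preserved, as distinct elements may share a value. *)
Lemma signed_abs_lt (x y : F) : signed_abs w x < signed_abs w y -> x < y.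
Proof. by rewrite !ltNge; apply: contra => /signed_abs_le. Qed.

End SignedAbs.

(** An interval around 0 contains the value of 0; one on the negative side is reflected to the
    positive side. *)
Lemma signed_abs_dense (R : realType) (K : rcfType) (v : nonarch_abs K R) (s t : R) :
  (exists a : K, a <> 0 /\ v a <> 1) -> s < t ->
  exists a : K, s < signed_abs v a < t.
Proof.
move=> nt st; have [s0|s0] := leP 0 s.
  have [a a0 sat] := abs_dense_pos v nt _ _ s0 st.
  by exists a; rewrite /signed_abs ltW.
have [t0|t0] := ltP 0 t.
  by exists 0; rewrite /signed_abs lexx (abs_eq0 v 0).2// s0.
have [a a0 /andP[ta as_]] : exists2 a : K, 0 < a & - t < v a < - s.
  by apply: abs_dense_pos nt _ _ _ _; rewrite ?oppr_ge0// ltrN2.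
exists (- a); rewrite signed_absN /signed_abs ltW//.
by rewrite ltrNr as_ ltrNl.
Qed.

(** * Extending the absolute value to an ordered extension field *)

Section ArchimedeanExtension.
Context {R : realType} {K : rcfType} {L : realFieldType}.
Context (v : nonarch_abs K R) (iota : {rmorphism K -> L}).
Hypothesis v_compatible : forall a b : K, 0 <= a -> a <= b -> v a <= v b.
Hypothesis v_nontrivial : exists a : K, a <> 0 /\ v a <> 1.

(** Nonnegative elements of a real closed field are squares, so a ring morphism to an ordered field
    is monotone; injectivity gives the converse. *)
Lemma rcf_morph_le (a b : K) : (iota a <= iota b) = (a <= b).
Proof.
have mono (x y : K) : x <= y -> iota x <= iota y.
  move=> xy; rewrite -subr_ge0 -rmorphB -[y - x]sqr_sqrtr ?subr_ge0//.
  by rewrite rmorphXn sqr_ge0.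
apply/idP/idP => [ab|]; last exact: mono.
have [//|ba] := leP a b.
have /(fmorph_inj iota) eab : iota a = iota b.
  by apply: le_anti; rewrite ab mono// ltW.
by move: ba; rewrite eab ltxx.
Qed.

Lemma rcf_morph_lt (a b : K) : (iota a < iota b) = (a < b).
Proof. by rewrite !ltNge rcf_morph_le. Qed.

Section Extension.
Context (w : nonarch_abs L R).
Hypothesis w_ext : forall a, w (iota a) = v a.
Hypothesis w_compatible : forall a b : L, 0 <= a -> a <= b -> w a <= w b.

Lemma signed_abs_morph (a : K) : signed_abs w (iota a) = signed_abs v a.
Proof. by rewrite /signed_abs -(rmorph0 iota) rcf_morph_le w_ext. Qed.

(** By density some positive [a] has [v a > w b]; compatibility then excludes [iota a < b]. *)
Lemma extension_archimedean (b : L) : exists a : K, b <= iota a.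
Proof.
have wb1 : w b < w b + 1 by rewrite ltrDl.
have [a a0 /andP[ba _]] := abs_dense_pos v v_nontrivial _ _ (abs_ge0 w b) wb1.
exists a; rewrite leNgt; apply/negP => /ltW ab.
have ia0 : 0 <= iota a by rewrite -(rmorph0 iota) rcf_morph_le ltW.
by move: (w_compatible _ _ ia0 ab); rewrite w_ext leNgt ba.
Qed.

End Extension.

(** The set is bounded below by 0; it is nonempty, so that [inf] is a true infimum, once [L] is
    archimedean over [K]. *)
Definition arch_abs (x : L) : R := inf [set v a | a in [set a | `|x| <= iota a]].

Section Archimedean.
Hypothesis iota_arch : forall b : L, exists a : K, b <= iota a.

Lemma arch_abs_nonempty (x : L) : [set v a | a in [set a | `|x| <= iota a]] !=set0.
Proof. by have [a xa] := iota_arch `|x|; exists (v a), a. Qed.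

Lemma arch_abs_le (x : L) (a : K) : `|x| <= iota a -> arch_abs x <= v a.
Proof.
move=> xa; apply: ge_inf; last by exists a.
by exists 0 => _ [b _ <-]; exact: abs_ge0.
Qed.

Lemma le_arch_abs (x : L) (r : R) :
  (forall a, `|x| <= iota a -> r <= v a) -> r <= arch_abs x.
Proof.
by move=> h; apply: lb_le_inf; [exact: arch_abs_nonempty|move=> _ [a /h ? <-]].
Qed.

Lemma morph_le_arch_abs (x : L) (a : K) : 0 <= a -> iota a <= `|x| -> v a <= arch_abs x.
Proof.
move=> a0 ax; apply: le_arch_abs => b /(le_trans ax).
by rewrite rcf_morph_le; exact: v_compatible.
Qed.

Lemma lt_arch_abs (x : L) (a : K) : v a < arch_abs x -> iota a <= `|x|.
Proof.
by rewrite !leNgt; apply: contraL => /ltW/arch_abs_le; rewrite leNgt.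
Qed.

Lemma arch_abs_ge0 (x : L) : 0 <= arch_abs x.
Proof. by apply: le_arch_abs => a _; exact: abs_ge0. Qed.

(** On [K] the infimum is attained, at the order-theoretic [|a|]. *)
Lemma arch_absE (a : K) : arch_abs (iota a) = v a.
Proof.
have an : `|iota a| = iota `|a|.
  have [a0|a0] := leP 0 a.
    by rewrite !ger0_norm// -(rmorph0 iota) rcf_morph_le.
  by rewrite !ltr0_norm ?rmorphN// -(rmorph0 iota) rcf_morph_lt.
have va : v `|a| = v a by case: (ger0P a); rewrite ?absN.
apply/eqP; rewrite eq_le -va arch_abs_le ?an//=.
by rewrite morph_le_arch_abs ?an.
Qed.

Lemma arch_abs_mono (x y : L) : `|x| <= `|y| -> arch_abs x <= arch_abs y.
Proof. by move=> xy; apply: le_arch_abs => a /(le_trans xy)/arch_abs_le. Qed.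

(** If [a] bounds [1 / |x|], then [1 / a] is a positive element of [K] below [|x|]. *)
Lemma arch_abs_gt0 (x : L) : x != 0 -> 0 < arch_abs x.
Proof.
move=> x0; have [a xa] := iota_arch `|x|^-1.
have xi0 : 0 < `|x|^-1 by rewrite invr_gt0 normr_gt0.
have a0 : 0 < a by rewrite -rcf_morph_lt rmorph0 (lt_le_trans xi0).
apply: (@lt_le_trans _ _ (v a^-1)); first by rewrite abs_gt0// invr_eq0 gt_eqF.
apply: morph_le_arch_abs; first by rewrite invr_ge0 ltW.
by rewrite fmorphV -[leRHS]invrK lef_pV2// posrE (lt_le_trans xi0).
Qed.

Lemma arch_abs_eq0 (x : L) : arch_abs x = 0 <-> x = 0.
Proof.
split=> [x0|->]; last by rewrite -(rmorph0 iota) arch_absE (abs_eq0 v 0).2.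
by apply/eqP; apply: contraPT x0 => /arch_abs_gt0 x0 e; rewrite e ltxx in x0.
Qed.

(** A product of upper bounds bounds the product; the infimum is taken over one factor at a time,
    after dividing by the other positive value. *)
Lemma arch_abs_submul (x y : L) : arch_abs (x * y) <= arch_abs x * arch_abs y.
Proof.
have [->|x0] := eqVneq x 0; first by rewrite mul0r (arch_abs_eq0 0).2// mul0r.
have [->|y0] := eqVneq y 0; first by rewrite mulr0 (arch_abs_eq0 0).2// mulr0.
rewrite -ler_pdivrMl ?arch_abs_gt0//; apply: le_arch_abs => b yb.
have vb : 0 < v b.
  by apply: lt_le_trans (arch_abs_le _ _ yb); exact: arch_abs_gt0.
rewrite ler_pdivrMl ?arch_abs_gt0// -ler_pdivrMr//.
apply: le_arch_abs => a xa; rewrite ler_pdivrMr// -absM.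
by apply: arch_abs_le; rewrite normrM rmorphM ler_pM.
Qed.

(** Otherwise density puts some [v a] strictly between the inverse of [arch_abs x^-1] and
    [arch_abs x]. Then [a <= |x|], so [1 / a] bounds [|1 / x|], which contradicts the choice of
    [a]. *)
Lemma arch_abs_inv_le (x : L) : x != 0 -> arch_abs x^-1 <= (arch_abs x)^-1.
Proof.
move=> x0; have x0' := arch_abs_gt0 _ x0.
have xi0 : 0 < arch_abs x^-1 by rewrite arch_abs_gt0// invr_eq0.
rewrite -[leLHS]invrK lef_pV2 ?posrE ?invr_gt0// leNgt; apply/negP => lt.
have [a a0 /andP[ia ax]] :=
  abs_dense_pos v v_nontrivial _ _ (ltW (etrans (invr_gt0 _) xi0)) lt.
have ia0 : 0 < iota a by rewrite -(rmorph0 iota) rcf_morph_lt.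
have : arch_abs x^-1 <= v a^-1.
  apply: arch_abs_le; rewrite normfV fmorphV lef_pV2 ?posrE ?normr_gt0//.
  exact: lt_arch_abs.
rewrite absV -[leLHS]invrK lef_pV2 ?posrE ?invr_gt0//; last by rewrite abs_gt0// gt_eqF.
by rewrite leNgt ia.
Qed.

(** The missing inequality is submultiplicativity applied to [y = x^-1 * (x * y)]. *)
Lemma arch_absM (x y : L) : arch_abs (x * y) = arch_abs x * arch_abs y.
Proof.
apply/eqP; rewrite eq_le arch_abs_submul/=.
have [->|x0] := eqVneq x 0; first by rewrite mul0r (arch_abs_eq0 0).2// mul0r.
rewrite -ler_pdivlMl ?arch_abs_gt0// -{1}[y](mulKf x0).
apply: le_trans (arch_abs_submul _ _) _; rewrite ler_wpM2r ?arch_abs_ge0//.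
exact: arch_abs_inv_le.
Qed.

(** If [|y| <= |x|], then [|x + y| <= |2 x|], and [v 2 <= 1] because [v] is non-archimedean. *)
Lemma arch_absD (x y : L) : arch_abs (x + y) <= Num.max (arch_abs x) (arch_abs y).
Proof.
wlog yx : x y / `|y| <= `|x|.
  by move=> wl; have [/wl//|/ltW/wl] := leP `|y| `|x|; rewrite addrC maxC.
rewrite le_max; apply/orP; left.
apply: (@le_trans _ _ (arch_abs (iota 2 * x))).
  apply: arch_abs_mono; rewrite (le_trans (ler_normD _ _))//.
  by rewrite normrM rmorph_nat normr_nat mulr_natl mulr2n lerD2l.
rewrite arch_absM arch_absE ler_piMl ?arch_abs_ge0//.
by rewrite (le_trans (absD v 1 1))// maxxx abs1.
Qed.

Definition arch_nonarch_abs : nonarch_abs L R :=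
  NonarchAbs arch_abs_ge0 arch_abs_eq0 arch_absM arch_absD.

End Archimedean.

(** Compatibility bounds [w x] by [v a] for every upper bound [a] of [|x|]. Were [w x] smaller than
    the infimum, density would give [a <= |x|] with [v a > w x]. *)
Lemma compatible_extension_unique (w : nonarch_abs L R) :
  (forall a, w (iota a) = v a) -> (forall a b : L, 0 <= a -> a <= b -> w a <= w b) ->
  w =1 arch_abs.
Proof.
move=> w_ext w_comp x.
have arch := extension_archimedean w w_ext w_comp.
have -> : w x = w `|x| by case: (ger0P x); rewrite ?absN.
apply/eqP; rewrite eq_le; apply/andP; split.
  by apply: le_arch_abs => // a xa; rewrite -w_ext w_comp.
rewrite leNgt; apply/negP => lt.
have [a a0 /andP[wa ax]] := abs_dense_pos v v_nontrivial _ _ (abs_ge0 w _) lt.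
have ia0 : 0 <= iota a by rewrite -(rmorph0 iota) rcf_morph_le ltW.
by move: (w_comp _ _ ia0 (lt_arch_abs _ _ ax)); rewrite w_ext leNgt wa.
Qed.

End ArchimedeanExtension.

(* An alias of [F], on which the order [P] gives a [realFieldType]. *)
Definition ordered_by {F : fieldType} (P : ordering F) : Type := F.

(** * Ordered fields obtained from orderings *)

Section OrderedBy.
Context {F : fieldType} (P : ordering F).

HB.instance Definition _ := GRing.Field.on (ordered_by P).

Definition ord_le (x y : ordered_by P) : bool := `[< P (y - x) >].
Definition ord_lt (x y : ordered_by P) : bool := (y != x) && ord_le x y.
Definition ord_norm (x : ordered_by P) : ordered_by P := if ord_le 0 x then x else - x.

Lemma ord_le0E (x : ordered_by P) : ord_le 0 x = `[< P x >].
Proof. by rewrite /ord_le subr0. Qed.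

Lemma ord_leN0 (x : ordered_by P) : ord_le x 0 = `[< P (- x) >].
Proof. by rewrite /ord_le sub0r. Qed.

Lemma ord_le0D (x y : ordered_by P) : ord_le 0 x -> ord_le 0 y -> ord_le 0 (x + y).
Proof. by rewrite !ord_le0E => /asboolP ? /asboolP ?; apply/asboolP; exact: nonnegD. Qed.

Lemma ord_le0M (x y : ordered_by P) : ord_le 0 x -> ord_le 0 y -> ord_le 0 (x * y).
Proof. by rewrite !ord_le0E => /asboolP ? /asboolP ?; apply/asboolP; exact: nonnegM. Qed.

Lemma ord_le0_anti (x : ordered_by P) : ord_le 0 x -> ord_le x 0 -> x = 0.
Proof.
by rewrite ord_le0E ord_leN0 => /asboolP Px /asboolP PNx; exact: nonneg_anti PNx.
Qed.

Lemma ord_sub_ge0 (x y : ordered_by P) : ord_le 0 (y - x) = ord_le x y.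
Proof. by rewrite ord_le0E. Qed.

Lemma ord_le0_total (x : ordered_by P) : ord_le 0 x || ord_le x 0.
Proof.
rewrite ord_le0E ord_leN0.
by have [Px|Px] := nonneg_total P x; apply/orP; [left|right]; apply/asboolP.
Qed.

Lemma ord_normN (x : ordered_by P) : ord_norm (- x) = ord_norm x.
Proof.
rewrite /ord_norm opprK; case: (boolP (ord_le 0 (- x))) => [Nx|Nx];
  case: (boolP (ord_le 0 x)) => [px|px] //.
- have -> : x = 0; last by rewrite oppr0.
  by apply: ord_le0_anti => //; rewrite ord_leN0 -ord_le0E.
- by have := ord_le0_total x; rewrite (negPf px) ord_leN0 -ord_le0E (negPf Nx).
Qed.

Lemma ord_ge0_norm (x : ordered_by P) : ord_le 0 x -> ord_norm x = x.
Proof. by rewrite /ord_norm => ->. Qed.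

HB.instance Definition _ := Num.IntegralDomain_isLeReal.Build (ordered_by P)
  ord_le0D ord_le0M ord_le0_anti ord_sub_ge0 ord_le0_total ord_normN ord_ge0_norm
  (fun x y => erefl (ord_lt x y)).

Lemma ordered_ge0 (x : ordered_by P) : (0 <= x) = `[< P x >].
Proof. exact: ord_le0E. Qed.

Lemma ordered_gt0 (x : ordered_by P) : 0 < x <-> pos_for P x.
Proof.
rewrite lt0r ordered_ge0 /pos_for; split.
  by move=> /andP[/eqP x0 /asboolP Px].
by move=> [Px /eqP x0]; rewrite x0; apply/asboolP.
Qed.


Lemma ordered_ge0P (x : F) : P x <-> 0 <= (x : ordered_by P).
Proof. by rewrite ordered_ge0; split=> /asboolP. Qed.

Section OrderedAbs.
Context {R : realType}.

Definition ordered_abs (w : nonarch_abs F R) : nonarch_abs (ordered_by P) R :=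
  @NonarchAbs (ordered_by P) R w (abs_ge0 w) (abs_eq0 w) (absM w) (absD w).

Definition unordered_abs (w : nonarch_abs (ordered_by P) R) : nonarch_abs F R :=
  @NonarchAbs F R w (abs_ge0 w) (abs_eq0 w) (absM w) (absD w).

Lemma compatible_ordered (w : nonarch_abs F R) :
  compatible w P <->
  forall a b : ordered_by P, 0 <= a -> a <= b -> ordered_abs w a <= ordered_abs w b.
Proof.
split=> h a b.
  by move=> /ordered_ge0P a0; rewrite -subr_ge0 => /ordered_ge0P ab; exact: h.
by move=> /ordered_ge0P a0 /ordered_ge0P ab; apply: h => //; rewrite -subr_ge0.
Qed.

Lemma signed_abs_sgn (w : nonarch_abs F R) (x : F) :
  sgn_for R P x * w x = @signed_abs (ordered_by P) R w x.
Proof.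
rewrite /signed_abs ordered_ge0 /sgn_for.
case: eqP => [->|_]; first by rewrite (abs_eq0 w 0).2// mul0r oppr0 if_same.
by case: ifP => _; rewrite ?mul1r ?mulN1r.
Qed.

End OrderedAbs.

Section OrderedMorphism.
Context {K : fieldType} (f : {rmorphism K -> F}).

Definition ordered_morph : K -> ordered_by P := f.

Fact ordered_morph_is_zmod_morphism : zmod_morphism ordered_morph.
Proof. exact: rmorphB. Qed.

Fact ordered_morph_is_monoid_morphism : monoid_morphism ordered_morph.
Proof. by split; [exact: rmorph1|exact: rmorphM]. Qed.

HB.instance Definition _ := GRing.isZmodMorphism.Build K (ordered_by P)
  ordered_morph ordered_morph_is_zmod_morphism.
HB.instance Definition _ := GRing.isMonoidMorphism.Build K (ordered_by P)
  ordered_morph ordered_morph_is_monoid_morphism.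

End OrderedMorphism.

End OrderedBy.

Lemma nonarch_abs_inj (F : fieldType) (R : realType) (w1 w2 : nonarch_abs F R) :
  w1 =1 w2 -> w1 = w2.
Proof.
case: w1 w2 => [f a b c d] [g a' b' c' d'] /= /funext fg; subst g.
by congr NonarchAbs; exact: Prop_irrelevance.
Qed.


(** Serves to clear denominators without changing signs. *)
Lemma pos_for_mul_sqr (F : fieldType) (P : ordering F) (x y : F) :
  y <> 0 -> pos_for P (x * y ^+ 2) <-> pos_for P x.
Proof.
move=> /eqP y0; have y2 : 0 < (y ^+ 2 : ordered_by P).
  by rewrite exprn_even_gt0.
rewrite -!ordered_gt0.
by rewrite -[X in 0 < X]/((x : ordered_by P) * (y ^+ 2 : ordered_by P)) pmulr_lgt0.
Qed.

(** * Basic open sets in prime spectra and affine opens *)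

(** Induction on the number of intersected sets; it reduces openness of preimages to the subbasic
    sets. *)
Lemma finI_from_ind (I : choiceType) (T : Type) (D : set I) (f : I -> set T)
    (Q : set T -> Prop) (B : set T) :
  Q setT -> (forall i U, D i -> Q U -> Q (f i `&` U)) -> finI_from D f B -> Q B.
Proof.
move=> QT QI [J sJ <-]; rewrite bigcap_fset big_seq; apply: big_rec => // i U iJ.
by apply: QI; have := sJ i iJ; rewrite inE.
Qed.

Lemma basic_open_mul (A : comPzRingType) (f g : A) :
  basic_open (f * g) = basic_open f `&` basic_open g.
Proof.
apply/seteqP; split=> p; rewrite /basic_open /=.
  by move=> pfg; split=> [pf|pg]; apply: pfg; [rewrite mulrC|]; exact: pidealM.
by move=> [pf pg] /pideal_prime[].
Qed.

Lemma prime_open_generated (A : comPzRingType) (W : set (primeIdeal A)) :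
  open W -> generated_open (range (@basic_open A)) W.
Proof.
by move=> [D' sD <-] p [B DB Bp]; exists B; split=> // [|q Bq]; [exact: sD|exists B].
Qed.

(** The subbase of the sets [basic_open f] is a base, being closed under finite intersections: [f]
    and [g] give [f * g], the empty intersection gives 1. *)
Lemma prime_open_nbhs (A : comPzRingType) (W : set (primeIdeal A)) (p : primeIdeal A) :
  open W -> W p -> exists2 f : A, ~ p f & basic_open f `<=` W.
Proof.
move=> /prime_open_generated/[apply] -[B [finB Bp BW]].
have [f BE] : exists f, B = basic_open f.
  apply: (finI_from_ind _ _ _ _ (fun B => exists f, B = basic_open f)) finB => [|_ U [h _ <-] [g ->]].
    by exists 1; apply/seteqP; split=> q // _; exact: pideal_proper.
  by exists (h * g); rewrite basic_open_mul.
by exists f; rewrite -?BE //; move: Bp; rewrite BE.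
Qed.

Section AffineOpen.
Context {X : ringedSpace} {V : opens X} {A : comPzRingType}.
Context (phi : set_type V -> primeIdeal A).
Hypothesis phi_homeo : homeomorphism phi.

Lemma basic_locus_open (f : A) : open (set_val @` (phi @^-1` basic_open f) : set X).
Proof.
have : open (phi @^-1` basic_open f).
  move/continuousP: phi_homeo.1; apply.
  exists [set basic_open f]; last by rewrite bigcup_set1.
  by move=> _ ->; apply: finI_from1; exists f.
move=> [W oW WE].
have -> : set_val @` (phi @^-1` basic_open f) = W `&` V.
  rewrite -WE; apply/seteqP; split=> [_ [x Wx <-]|x [Wx Vx]].
    by split=> //; exact: set_valP.
  by exists (SigSub (mem_set Vx)).
exact: openI oW (opens_open V).
Qed.

Definition basic_locus (f : A) : opens X := Opens (basic_locus_open f).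

Lemma basic_locus_sub (f : A) : basic_locus f `<=` V.
Proof. by move=> _ [x _ <-]; exact: set_valP. Qed.

Lemma basic_locus_nbhs (U : opens X) (x : set_type V) : U (set_val x) ->
  exists2 f : A, ~ phi x f & basic_locus f `<=` U.
Proof.
move=> Ux; have [_ [g [phiK gK gc]]] := phi_homeo.
have oU : open (g @^-1` (set_val @^-1` U)).
  by move/continuousP: gc; apply; exists U => //; exact: opens_open.
have [|f pf fU] := prime_open_nbhs _ _ (phi x) oU; first by rewrite /= phiK.
exists f => // _ [y yf <-].
by have := fU _ yf; rewrite /= phiK.
Qed.

End AffineOpen.

(** * Values of sections in residue fields *)

Section ValueMorphism.
Context {X : lrSpace} {p : X} {U : opens X} (h : U p).

Fact value_is_zmod_morphism : zmod_morphism (value h).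
Proof. by move=> s t; rewrite /value !rmorphB. Qed.

Fact value_is_monoid_morphism : monoid_morphism (value h).
Proof. by split=> [|s t]; rewrite /value ?rmorph1// !rmorphM. Qed.

HB.instance Definition _ := GRing.isZmodMorphism.Build (sect X U) (residue p)
  (value h) value_is_zmod_morphism.
HB.instance Definition _ := GRing.isMonoidMorphism.Build (sect X U) (residue p)
  (value h) value_is_monoid_morphism.

End ValueMorphism.

Lemma value_res {X : lrSpace} (p : X) (U W : opens X) (hU : U p) (hW : W p)
    (h : W `<=` U) (s : sect X U) :
  value hW (res U W h s) = value hU s.
Proof. by rewrite /value (germ_res hU). Qed.

Section AffineValue.
Context {X : lrSpace} {V : opens X} {A : comPzRingType}.
Context (rho : {rmorphism A -> sect X V}) (phi : set_type V -> primeIdeal A).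
Hypothesis phi_homeo : homeomorphism phi.
Hypothesis rho_loc : forall (f : A) (U : opens X) (h : U `<=` V),
  opens_set U = set_val @` (phi @^-1` basic_open f) ->
  is_localization f (res V U h \o rho).

Let D (f : A) := basic_locus phi phi_homeo f.
Let rho_locD (f : A) (h : D f `<=` V) := rho_loc f (D f) h erefl.

Lemma prime_exp (p : primeIdeal A) (f : A) n : p (f ^+ n) -> p f.
Proof.
elim: n => [|n IH]; first by move/pideal_proper.
by rewrite exprS => /pideal_prime[].
Qed.

(** Identifies [phi x] with the functions vanishing at [x]. If [f] is not in [phi x], it is
    invertible on [D f], hence in the stalk. Conversely, an inverse of its germ is a fraction
    [a / g ^ n] on some [D g] around [x]. *)
Lemma value_neq0 (x : set_type V) (hx : V (set_val x)) (f : A) :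
  value hx (rho f) <> 0 <-> ~ phi x f.
Proof.
rewrite /value stalk_eval_eq0; split; last first.
  move=> pf; apply; have [[y ey] _ _] := rho_locD f (basic_locus_sub phi phi_homeo f).
  have hxf : D f (set_val x) by exists x.
  exists (germ hxf y).
  by rewrite -(germ_res hx hxf (basic_locus_sub phi phi_homeo f)) -rmorphM ey rmorph1.
move=> /contrapT[z]; have [W [hW [s ->]]] := stalkP z.
pose O := opensI V W.
have OV : O `<=` V by move=> ? [].
have OW : O `<=` W by move=> ? [].
have hO : O (set_val x) by [].
rewrite -(germ_res hx hO OV) -(germ_res hW hO OW) -rmorphM -(rmorph1 (germ hO)).
move=> /germ_eqP[W' [h1 [h2 [W'x]]]].
rewrite rmorphM rmorph1.
have [g pg gW] := basic_locus_nbhs phi phi_homeo W' x W'x.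
move=> /(congr1 (res W' (D g) gW)); rewrite rmorphM rmorph1.
have DV : D g `<=` V by exact: basic_locus_sub.
have DO : D g `<=` O by move=> y /gW/h1.
have DW : D g `<=` W by move=> y /DO/OW.
rewrite !(res_comp _ _ DO) (res_comp _ _ DV) (res_comp _ _ DW).
have [_ /(_ (res W (D g) DW s))[a [n sE]] gker] := rho_locD g DV.
(* Clearing the denominator gives [g ^ m * (f * a) = g ^ (m + n)] in [A], so [f] in [phi x] would
   force [g] into it. *)
move=> /(congr1 (fun t => t * (res V (D g) DV \o rho) g ^+ n)).
rewrite -mulrA sE mul1r -[res _ _ _ _]/((res V (D g) DV \o rho) f).
rewrite -rmorphM -rmorphXn => /eqP; rewrite -subr_eq0 -rmorphB => /eqP/gker[m].
move=> /eqP; rewrite mulrBr subr_eq0 -exprD => /eqP E pf.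
apply: pg; apply: (@prime_exp _ _ (m + n)); rewrite -E.
by apply: pidealM; rewrite mulrC; exact: pidealM.
Qed.

End AffineValue.

(** * Positivity loci in the real spectrum *)

Section PosLocus.
Context {K : fieldType} (X : kscheme K).

(** Openness is tested with sections over a whole affine [V], so [g] is replaced near [y] by a
    section over [V] whose positivity locus stays within that of [g]. *)
Lemma pos_locus_open (U : opens X) (g : sect X U) : open (pos_locus g).
Proof.
move=> V aV y [[Uy gy] /= Vy].
have [A [rho [phi [phiH rhoL]]]] := aV.
pose x : set_type V := SigSub (mem_set Vy).
have [h ph hU] := basic_locus_nbhs phi phiH U x Uy.
pose D := basic_locus phi phiH h.
have DV : D `<=` V by exact: basic_locus_sub.
have [_ /(_ (res U D hU g))[a [n gE]] _] := rhoL h D DV erefl.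
(* With [g = a / h ^ n], the product [a * h ^ (n + 2)] is [g] times the square of [h ^ (n + 1)]. The
   extra 2 leaves a factor [h] even for [n = 0], so the product vanishes outside [D]. *)
have posE (z : real_space X) (Uz : U (real_supp z)) (Vz : V (real_supp z)) :
    D (real_supp z) ->
    pos_for (real_ord z) (value Vz (rho (a * h ^+ n.+2))) <->
    pos_for (real_ord z) (value Uz g).
  move=> Dz.
  have h0 : value Vz (rho h) <> 0.
    apply/(value_neq0 rho phi phiH rhoL (SigSub (mem_set Vz)) Vz h).
    case: Dz => z' hz' zz'; suff -> : SigSub (mem_set Vz) = z' by [].
    exact: val_inj.
  rewrite -(pos_for_mul_sqr _ _ (value Uz g) (value Vz (rho h) ^+ n.+1)); last first.
    by apply/eqP; rewrite expf_neq0//; apply/eqP.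
  suff -> : value Vz (rho (a * h ^+ n.+2)) = value Uz g * value Vz (rho h) ^+ n.+1 ^+ 2 by [].
  have -> : value Vz (rho (a * h ^+ n.+2)) = value Vz (rho a) * value Vz (rho h) ^+ n.+2.
    by rewrite (rmorphM rho) (rmorphXn rho) rmorphM rmorphXn.
  have -> : value Vz (rho a) = value Uz g * value Vz (rho h) ^+ n.
    rewrite -(value_res _ _ _ Vz Dz DV) -[X in value Dz X]gE.
    rewrite -(value_res _ _ _ Uz Dz hU) -(value_res _ _ _ Vz Dz DV).
    by rewrite rmorphM rmorphXn.
  by rewrite -mulrA -exprD -exprM muln2 -addnn !addSn !addnS.
have Dy : D (real_supp y) by exists x.
exists (pos_locus (rho (a * h ^+ n.+2))); split.
- by apply: finI_from1; exists (rho (a * h ^+ n.+2)).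
- by exists Vy; apply/(posE y Uy Vy Dy).
- move=> z [Vz zpos]; split=> //.
  have Dz : D (real_supp z).
    exists (SigSub (mem_set Vz)) => //.
    apply/(value_neq0 rho phi phiH rhoL (SigSub (mem_set Vz)) Vz h) => h0.
    case: zpos => _; apply.
    have -> : a * h ^+ n.+2 = h * (a * h ^+ n.+1) by rewrite exprS mulrCA.
    by rewrite (rmorphM rho) (rmorphM (value Vz)) /= (h0 : value Vz _ = 0) mul0r.
  by exists (hU _ Dz); apply/(posE z (hU _ Dz) Vz Dz).
Qed.

End PosLocus.

(** * Topology and points of the analytification *)

Lemma an_open_generated (R : realType) (K : fieldType) (v : nonarch_abs K R)
    (X : kscheme K) (W : set (an_space v X)) :
  open W -> generated_open (@an_subbase K R v X) W.
Proof.
by move=> [D' sD <-] p [B DB Bp]; exists B; split=> // [|q Bq]; [exact: sD|exists B].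
Qed.

Lemma an_subbase_open (R : realType) (K : fieldType) (v : nonarch_abs K R)
    (X : kscheme K) (B : set (an_space v X)) :
  an_subbase B -> open B.
Proof.
move=> SB; exists [set B]; last by rewrite bigcup_set1.
by move=> _ ->; exact: (finI_from1 id SB).
Qed.

Lemma locally_open (T : topologicalType) (A : set T) :
  (forall x, A x -> exists U, [/\ open U, U x & U `<=` A]) -> open A.
Proof.
move=> h; rewrite openE => x /h[U [oU Ux UA]].
by rewrite /interior nbhsE; exists U.
Qed.

Lemma real_point_eta (K : fieldType) (X : kscheme K) (x : real_space X) :
  RealPoint (real_ord x) = x.
Proof. by case: x. Qed.

Lemma an_point_eq (R : realType) (K : fieldType) (v : nonarch_abs K R) (X : kscheme K)
    (p : X) (P : ordering (residue p)) (w1 w2 : nonarch_abs (residue p) R)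
    (ext1 : forall a, w1 (kvalue p a) = v a) (ext2 : forall a, w2 (kvalue p a) = v a)
    (compat1 : compatible w1 P) (compat2 : compatible w2 P) :
  w1 =1 w2 -> AnPoint ext1 compat1 = AnPoint ext2 compat2.
Proof.
by move/nonarch_abs_inj => w12; subst w2; congr AnPoint; exact: Prop_irrelevance.
Qed.

(** Makes the preimage of a positivity locus a subbasic set of the analytification. *)
Lemma pos_for_sgn (R : realType) (F : fieldType) (P : ordering F)
    (w : nonarch_abs F R) (x : F) :
  pos_for P x <-> 0 < sgn_for R P x * w x.
Proof.
rewrite /sgn_for /pos_for; case: eqP => [->|/[dup] x0 /eqP/(abs_gt0 w) wx].
  by rewrite mul0r ltxx; split=> // -[].
case: asboolP => Px; first by rewrite mul1r wx.
by rewrite mulN1r oppr_gt0 ltNge ltW//; split=> // -[].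
Qed.

Section AnalyticPoint.
Context {R : realType} {K : rcfType} {v : nonarch_abs K R} {X : kscheme K}.
Context (x : an_space v X) {U : opens X} (h : U (an_supp x)).

Let w := ordered_abs (an_ord x) (an_abs x).
Let w_compatible := (compatible_ordered _ (an_abs x)).1 (@an_compat _ _ _ _ x).

Lemma an_eval_signed (f : sect X U) : an_eval f h = signed_abs w (value h f).
Proof. exact: signed_abs_sgn. Qed.

Lemma an_eval_lt (f g : sect X U) :
  an_eval f h < an_eval g h -> pos_for (an_ord x) (value h (g - f)).
Proof.
rewrite !an_eval_signed => /(signed_abs_lt w w_compatible).
by rewrite -subr_gt0 => /ordered_gt0; rewrite rmorphB.
Qed.

Lemma an_eval_le (f g : sect X U) :
  pos_for (an_ord x) (value h (g - f)) -> an_eval f h <= an_eval g h.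
Proof.
rewrite rmorphB => /ordered_gt0 fg; rewrite !an_eval_signed.
by apply: signed_abs_le w_compatible _ _ _; rewrite -subr_ge0 ltW.
Qed.

End AnalyticPoint.

(** * The comparison map and its inverse *)

Section Comparison.
Context {R : realType} {K : rcfType} (v : nonarch_abs K R) {X : kscheme K}.
Hypothesis v_compatible : forall a b : K, 0 <= a -> a <= b -> v a <= v b.
Hypothesis v_nontrivial : exists a : K, a <> 0 /\ v a <> 1.

Section Point.
Context (p : X).

Fact kvalue_is_zmod_morphism : zmod_morphism (kvalue p).
Proof. by move=> a b; rewrite /kvalue !rmorphB. Qed.

Fact kvalue_is_monoid_morphism : monoid_morphism (kvalue p).
Proof. by split=> [|a b]; rewrite /kvalue ?rmorph1// !rmorphM. Qed.

HB.instance Definition _ := GRing.isZmodMorphism.Build K (residue p)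
  (kvalue p) kvalue_is_zmod_morphism.
HB.instance Definition _ := GRing.isMonoidMorphism.Build K (residue p)
  (kvalue p) kvalue_is_monoid_morphism.

End Point.

Definition okvalue {p : X} (P : ordering (residue p)) : {rmorphism K -> ordered_by P} :=
  ordered_morph P (kvalue p).

Lemma arch_locusP (x : real_space X) :
  arch_locus X x <-> forall b, exists a, b <= okvalue (real_ord x) a.
Proof.
split=> arch b; have [a ab] := arch b; exists a.
  by rewrite -subr_ge0; exact/ordered_ge0P.
by apply/ordered_ge0P; rewrite subr_ge0.
Qed.

Lemma forget_abs_arch (x : an_space v X) : arch_locus X (forget_abs x).
Proof.
apply/arch_locusP; apply: (extension_archimedean _ _ v_nontrivial (ordered_abs _ (an_abs x))).
  exact: an_ext.
exact/compatible_ordered/an_compat.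
Qed.

(** Constants have the same signed value at all points, so they can bound a section on a whole
    neighbourhood. *)
Lemma an_eval_const (x : an_space v X) (U : opens X) (h : U (an_supp x)) (a : K) :
  an_eval (ksect U a) h = signed_abs v a.
Proof.
rewrite an_eval_signed /ksect (value_res _ (opensT X) U I h).
apply: (signed_abs_morph v (okvalue (an_ord x)) (ordered_abs _ (an_abs x))).
exact: an_ext.
Qed.

Definition an_to_arch (x : an_space v X) : set_type (arch_locus X) :=
  SigSub (mem_set (forget_abs_arch x)).

Section Inverse.
Context (x : set_type (arch_locus X)).
Let P := real_ord (set_val x).
Let arch := (arch_locusP _).1 (set_valP x).

Definition arch_point_abs : nonarch_abs (residue (real_supp (set_val x))) R :=
  unordered_abs P (arch_nonarch_abs v (okvalue P) v_compatible v_nontrivial arch).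

Lemma arch_point_ext (a : K) : arch_point_abs (kvalue _ a) = v a.
Proof. exact: (arch_absE v (okvalue P)). Qed.

Lemma arch_point_compat : compatible arch_point_abs P.
Proof.
apply/compatible_ordered => a b a0 ab.
apply: (arch_abs_mono v (okvalue P) arch).
by rewrite !ger0_norm// (le_trans a0).
Qed.

Definition arch_to_an : an_space v X := AnPoint arch_point_ext arch_point_compat.

End Inverse.

Lemma an_to_archK : cancel an_to_arch arch_to_an.
Proof.
move=> x; rewrite /arch_to_an.
case: x => p w P ext compat; apply: an_point_eq => b.
apply/esym.
apply: (compatible_extension_unique v (okvalue P) v_nontrivial (ordered_abs P w)) => //.
exact/compatible_ordered.
Qed.

Lemma arch_to_anK : cancel arch_to_an an_to_arch.
Proof. by move=> x; apply: val_inj; exact: real_point_eta. Qed.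

Lemma forget_abs_continuous : continuous (@forget_abs K R v X).
Proof.
apply/continuousP => W oW; apply: locally_open => x Wx.
(* Open sets of the real spectrum are described only over affine opens, hence the restriction to one
   around the support. *)
have [V [Vx aV]] := sch_affine (an_supp x).
have [B [finB Bx BW]] := oW V aV (forget_abs x) (conj Wx Vx).
exists (@forget_abs K R v X @^-1` B); split=> //; last by move=> y /BW[].
apply: (finI_from_ind _ _ _ _ (fun B => open (@forget_abs K R v X @^-1` B))) finB.
  exact: openT.
move=> _ U [f _ <-] oU; apply: openI oU; apply: an_subbase_open; right.
exists V, f, [set r | 0 < r]; split.
  by move=> r r0; exists r => // r'; rewrite /= ltr_distlC subrr => /andP[].
by apply/seteqP; split=> y [h hy]; exists h; apply/(pos_for_sgn _ _ _ (an_abs y)).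
Qed.

Lemma an_to_arch_continuous : continuous an_to_arch.
Proof. by apply: continuous_comp_initial; exact: forget_abs_continuous. Qed.

Lemma arch_pos_locus_open (U : opens X) (f : sect X U) :
  open ([set x | pos_locus f (set_val x)] : set (set_type (arch_locus X))).
Proof. by exists (pos_locus f) => //; exact: pos_locus_open. Qed.

Lemma arch_to_an_continuous : continuous arch_to_an.
Proof.
apply/continuousP => W /an_open_generated gW; apply: locally_open => x /gW[B [finB Bx BW]].
exists (arch_to_an @^-1` B); split=> //; last by move=> y /BW.
apply: (finI_from_ind _ _ _ _ (fun B => open (arch_to_an @^-1` B))) finB.
  exact: openT.
move=> S U SS oU; apply: openI oU; move: SS => {B Bx BW x W gW U}.
case=> [[U oU <-]|[U [f [V [oV ->]]]]].
  (* The condition on the support is the positivity of the section 1. *)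
  by have := arch_pos_locus_open (Opens oU) 1; rewrite pos_locus1.
apply: locally_open => x [h Vt]; set t := an_eval f h in Vt.
have [e e0 eV] : exists2 e : R, 0 < e & ball t e `<=` V.
  by apply/nbhs_ballP; exact: open_nbhs_nbhs.
(* The constants [a] and [b] have signed values strictly on either side of [t], within [e]. Hence
   [a < f < b] at [x]; at other points this yields weak bounds, which suffice as both values lie
   strictly inside the ball. *)
have [a /andP[ta at_]] := signed_abs_dense _ _ v (t - e) t v_nontrivial ltac:(by rewrite gtrBl).
have [b /andP[tb bt]] := signed_abs_dense _ _ v t (t + e) v_nontrivial ltac:(by rewrite ltrDl).
exists ([set x | pos_locus (f - ksect U a) (set_val x)] `&`
        [set x | pos_locus (ksect U b - f) (set_val x)]); split.
- by apply: openI; exact: arch_pos_locus_open.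
- by split; exists h; apply: (an_eval_lt (arch_to_an x) h); rewrite an_eval_const.
- move=> y [[/= h1 f1] [h2 f2]]; exists h1; apply: eV.
  have := an_eval_le (arch_to_an y) h1 _ _ f1.
  have := an_eval_le (arch_to_an y) h2 _ _ f2.
  rewrite !an_eval_const (Prop_irrelevance h2 h1) => ub lb.
  by rewrite /ball/= ltr_distlC (lt_le_trans ta lb) (le_lt_trans ub bt).
Qed.

End Comparison.

Theorem theorem3p17 (R : realType) (K : rcfType) (v : nonarch_abs K R)
  (v_compatible : forall a b : K, 0 <= a -> a <= b -> v a <= v b)
  (v_nontrivial : exists a : K, a <> 0 /\ v a <> 1)
  (X : kscheme K) (X_variety : is_variety X) :
  exists psi : an_space v X -> set_type (arch_locus X),
    (forall x, set_val (psi x) = forget_abs x) /\ homeomorphism psi.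
Proof.
exists (an_to_arch v v_nontrivial); split=> //; split.
  exact: an_to_arch_continuous.
exists (arch_to_an v v_compatible v_nontrivial); split.
- exact: an_to_archK.
- exact: arch_to_anK.
- exact: arch_to_an_continuous.
Qed.
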